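(* If $\kappa$ is an infinite regular cardinal, then ${}^{<\kappa}\square\,2^\kappa$ is b-ultraparacompact (hence paracompact).
   Context: $2=\{0,1\}$ is discrete. ${}^{<\kappa}\square\,2^\kappa$ is the set of functions $\kappa\to2$ with the topology whose canonical base consists of the clopen sets $[s]=\{f:s\subseteq f\}$ for partial functions $s:\kappa\to2$ with $|\mathrm{dom}(s)|<\kappa$. The space is b-ultraparacompact if every open cover has a refinement (a cover each member of which is contained in a member of the given cover) consisting of pairwise disjoint sets from this canonical base. *)

(* Defs.v *)
From HB Require Import structures.
From mathcomp Require Import all_boot all_order.
From mathcomp Require Import all_classical topology.
From mathcomp Require wochoice.

Set Implicit Arguments.
Unset Strict Implicit.
Unset Printing Implicit Defensive.

Import Order.TTheory.
Local Open Scope classical_set_scope.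

Definition card_lt T U (A : set T) (B : set U) : bool :=
  (A #<= B)%card && ~~ (B #<= A)%card.

(* A cardinal is an initial ordinal: a well-ordered K each of whose proper
   initial segments has cardinality < |K|. *)
Definition is_cardinal d (K : orderType d) : Prop :=
  wochoice.well_order (<=%O : rel K) /\
  forall x : K, card_lt [set y : K | (y < x)%O] [set: K].

Definition cofinal d (K : orderType d) (A : set K) : Prop :=
  forall x : K, exists2 a, A a & (x <= a)%O.

(* The last field says cf(K) = K: since [set: K] is itself cofinal, the least
   cardinality of a cofinal subset is |K| iff no cofinal subset is smaller. *)
Record infinite_regular_cardinal d (K : orderType d) : Prop := {
  irc_cardinal : is_cardinal K;
  irc_infinite : infinite_set [set: K];
  irc_regular : forall A : set K, cofinal A -> ([set: K] #<= A)%card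
}.

Section PartialFunctions.
Variable K : Type.

Definition partial_fun : Type := K -> option bool.

Definition pdom (s : partial_fun) : set K := [set x | s x != None].

Definition small_pfun : set partial_fun :=
  [set s | card_lt (pdom s) [set: K]].

Definition cylinder (s : partial_fun) : set (K -> bool) :=
  [set f | forall x b, s x = Some b -> f x = b].

End PartialFunctions.

(* That the cylinders over small s form a base is not true for an arbitrary K
   (box_base_join uses hK), so the space takes the proof hK as a parameter. *)
Definition box_space d (K : orderType d) (hK : infinite_regular_cardinal K) :
  Type := K -> bool.

Section BoxSpace.
Variables (d : Order.disp_t) (K : orderType d).
Hypothesis hK : infinite_regular_cardinal K.

Lemma small_bounded (A : set K) :
  card_lt A [set: K] -> exists x, forall a, A a -> (a < x)%O.
Proof.
move=> /andP[_ nKA]; apply: contrapT => nb.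
move/negP: nKA; apply; apply: (irc_regular hK) => x.
apply: contrapT => na; apply: nb; exists x => a Aa.
by rewrite ltNge; apply/negP => xa; apply: na; exists a.
Qed.

Lemma bounded_small (A : set K) (x : K) :
  (forall a, A a -> (a < x)%O) -> card_lt A [set: K].
Proof.
move=> Ax; have /andP[_ nKx] := (irc_cardinal hK).2 x.
rewrite /card_lt card_leT /=; apply: contra nKx => /card_le_trans; apply.
exact: subset_card_le.
Qed.

Notation box_space := (box_space hK).

HB.instance Definition _ := Choice.on box_space.

Definition box_base (s : partial_fun K) : set box_space := cylinder s.

Lemma box_base_cover : \bigcup_(s in @small_pfun K) box_base s = setT.
Proof.
apply/seteqP; split=> // f _; exists (fun=> None) => //=.
rewrite /small_pfun /=.
have /set0P[x _] : [set: K] != set0.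
  by apply/eqP => K0; apply: (irc_infinite hK); rewrite K0.
by apply: (@bounded_small _ x) => a; rewrite /pdom.
Qed.

Lemma box_base_join (s t : partial_fun K) (f : box_space) :
  small_pfun s -> small_pfun t -> box_base s f -> box_base t f ->
  exists u, [/\ small_pfun u, box_base u f &
                box_base u `<=` box_base s `&` box_base t].
Proof.
move=> /small_bounded[x sx] /small_bounded[y ty] sf tf.
exists (fun k => if s k is Some b then Some b else t k); split.
- apply: (@bounded_small _ (Order.max x y)) => a; rewrite /pdom /= lt_max.
  case E: (s a) => [b|] ta; first by rewrite sx // /pdom /= E.
  by rewrite ty ?orbT.
- by move=> k b; case E: (s k) => [c|] // => [[<-]|]; [exact: sf|exact: tf].
- move=> g ug; split=> k b E; first by apply: ug; rewrite E.
  case F: (s k) => [c|]; last by apply: ug; rewrite F.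
  have -> : b = c by rewrite -(sf _ _ F) (tf _ _ E).
  by apply: ug; rewrite F.
Qed.

HB.instance Definition _ :=
  isBaseTopological.Build box_space box_base_cover box_base_join.

Definition canonical_base : set (set box_space) :=
  [set box_base s | s in @small_pfun K].

End BoxSpace.

Arguments canonical_base {d K} hK.

Definition covers X (C : set (set X)) : Prop := \bigcup_(U in C) U = setT.

Definition open_cover (X : topologicalType) (C : set (set X)) : Prop :=
  C `<=` open /\ covers C.

Definition refinement X (B C : set (set X)) : Prop :=
  covers B /\ forall V, B V -> exists2 U, C U & V `<=` U.

Definition b_ultraparacompact (X : topologicalType) (base : set (set X)) :
    Prop :=
  forall C : set (set X), open_cover C ->
    exists B, [/\ refinement B C, B `<=` base & trivIset B id].

Definition locally_finite (X : topologicalType) (B : set (set X)) : Prop :=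
  forall x : X, exists2 W, nbhs x W & finite_set [set V | B V /\ V `&` W !=set0].

(* Paracompact spaces are Hausdorff by definition (Engelking's convention). *)
Definition paracompact (X : topologicalType) : Prop :=
  hausdorff_space X /\
  forall C : set (set X), open_cover C ->
    exists B, [/\ refinement B C, B `<=` open & locally_finite B].

(* Main.v *)
Require Import Defs.
From mathcomp Require Import all_boot all_order.
From mathcomp Require Import all_classical topology.

(** Regularity bounds the domain of a small partial function, so the sets
    [[f|x]] of functions that agree with [f] below [x] already form a base.
    Given an open cover, let [x_f] be the least [x] such that [[f|x]] lies in
    one of its members. If [g] is in [[f|x_f]] then [[g|x_f] = [f|x_f]], so
    [x_g <= x_f]; then [f] is in [[g|x_g]] and [x_f <= x_g] by symmetry. Hence
    the sets [[f|x_f]] are pairwise equal or disjoint. *)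

Set Implicit Arguments.
Unset Strict Implicit.
Unset Printing Implicit Defensive.

Import Order.TTheory.
Local Open Scope classical_set_scope.

Lemma well_order_least d (K : orderType d) (A : set K) :
  wochoice.well_order (<=%O : rel K) -> A !=set0 ->
  exists2 x, A x & forall y, A y -> (x <= y)%O.
Proof.
move=> wo [x Ax].
have [|z [[zA z_min] _]] := wo (mem A); first by exists x; apply/mem_set.
by exists z => [|y Ay]; [apply/set_mem | apply: z_min; apply/mem_set].
Qed.

(** The member through [x] is itself a neighbourhood of [x], and by disjointness it meets no other
    member. *)
Lemma disjoint_open_cover_locally_finite (X : topologicalType)
    (B : set (set X)) :
  B `<=` open -> covers B -> trivIset B id -> locally_finite B.
Proof.
move=> Bopen Bcov Bdisj x.
have [V BV Vx] : (\bigcup_(V in B) V) x by rewrite Bcov.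
exists V; first by apply: open_nbhs_nbhs; split=> //; exact: Bopen.
apply: (sub_finite_set _ (finite_set1 V)) => W [BW WV].
exact: Bdisj WV.
Qed.

Lemma b_ultraparacompact_paracompact (X : topologicalType)
    (base : set (set X)) :
  hausdorff_space X -> base `<=` open -> b_ultraparacompact base ->
  paracompact X.
Proof.
move=> X_T2 base_open bup; split=> // C /bup[B [BC Bbase Bdisj]].
have Bopen := subset_trans Bbase base_open.
by exists B; split=> //; exact: disjoint_open_cover_locally_finite BC.1 Bdisj.
Qed.

Section InitialCylinders.
Variables (d : Order.disp_t) (K : orderType d).

Definition initial (f : K -> bool) (x : K) : partial_fun K :=
  fun y => if (y < x)%O then Some (f y) else None.

Lemma cylinder_initialP (f g : K -> bool) (x : K) :
  cylinder (initial f x) g <-> forall y, (y < x)%O -> g y = f y.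
Proof.
split=> [fg y yx | fg y b]; first by apply: fg; rewrite /initial yx.
by rewrite /initial; case: ifP => // yx [<-]; exact: fg.
Qed.

Lemma cylinder_initial_self (f : K -> bool) (x : K) :
  cylinder (initial f x) f.
Proof. exact/cylinder_initialP. Qed.

(** As with balls in an ultrametric space, every point of such a cylinder can serve as its
    centre. *)
Lemma eq_cylinder_initial (f g : K -> bool) (x : K) :
  cylinder (initial f x) g -> cylinder (initial f x) = cylinder (initial g x).
Proof.
move=> /cylinder_initialP fg.
apply/seteqP; split=> h /cylinder_initialP hx; apply/cylinder_initialP => y yx.
  by rewrite hx // fg.
by rewrite hx // fg.
Qed.

Lemma cylinder_initial_mono (f : K -> bool) (x y : K) :
  (x <= y)%O -> cylinder (initial f y) `<=` cylinder (initial f x).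
Proof.
move=> xy g /cylinder_initialP fg; apply/cylinder_initialP => z zx.
exact/fg/(lt_le_trans zx).
Qed.

Hypothesis hK : infinite_regular_cardinal K.

Lemma small_initial (f : K -> bool) (x : K) : small_pfun (initial f x).
Proof.
apply: (bounded_small hK (x := x)) => y.
by rewrite /pdom /initial /=; case: ifP.
Qed.

(** A singleton is small because [K] is infinite, so it is strictly bounded. *)
Lemma irc_no_max (x : K) : exists y, (x < y)%O.
Proof.
have [|y xy] := small_bounded hK (A := [set x]); last by exists y; exact: xy.
rewrite /card_lt card_leT /=; apply/negP => Kx.
exact: (irc_infinite hK) (card_le_finite Kx (finite_set1 x)).
Qed.

Lemma open_canonical_base : canonical_base hK `<=` open.
Proof.
move=> _ [s s_small <-]; exists [set s]; first by move=> _ ->.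
by rewrite bigcup_set1.
Qed.

Lemma open_contains_initial (U : set (box_space hK)) (f : box_space hK) :
  open U -> U f -> exists x, cylinder (initial f x) `<=` U.
Proof.
(* Openness presents [U] as the union of the [box_base s] for [s] in a set [S] of small partial
   functions. *)
move=> [S S_small <-] [s Ss sf].
have [x sx] := small_bounded hK (S_small _ Ss).
exists x => g /cylinder_initialP fg; exists s => // y b sy.
by rewrite fg ?(sf _ _ sy) // sx // /pdom /= sy.
Qed.

Lemma box_space_hausdorff : hausdorff_space (box_space hK).
Proof.
rewrite open_hausdorff => f g fg.
have [k fgk] : exists k, f k <> g k.
  apply: contrapT => eq_fg; move/eqP: fg; apply; apply: funext => k.
  by apply: contrapT => fgk; apply: eq_fg; exists k.
(* Since [initial f x] is undefined at [x], a bound strictly above [k] is needed for the two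
   cylinders to see that [f] and [g] differ at [k]. *)
have [x kx] := irc_no_max k.
exists (box_base (initial f x), box_base (initial g x)); split=> /=.
- by apply/mem_set/cylinder_initial_self.
- by apply/mem_set/cylinder_initial_self.
- apply: open_canonical_base.
  by exists (initial f x) => //; exact: small_initial.
- apply: open_canonical_base.
  by exists (initial g x) => //; exact: small_initial.
apply/eqP/seteqP; split=> // h [/cylinder_initialP hf /cylinder_initialP hg].
by apply: fgk; rewrite -hf // hg.
Qed.

Lemma box_space_b_ultraparacompact : b_ultraparacompact (canonical_base hK).
Proof.
move=> C [Copen Ccov].
pose inC (f : box_space hK) : set K :=
  [set x | exists2 U, C U & cylinder (initial f x) `<=` U].
have inC_least f : exists x, inC f x /\ forall y, inC f y -> (x <= y)%O.
  have [|x inx x_min] := well_order_least (A := inC f) (irc_cardinal hK).1.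
    have [U CU Uf] : (\bigcup_(U in C) U) f by rewrite Ccov.
    have [x fxU] := open_contains_initial (Copen _ CU) Uf.
    by exists x, U.
  by exists x.
(* [ht f] is the $x_f$ of the overview. *)
have [ht ht_least] := choice inC_least.
have ht_le f g : cylinder (initial f (ht f)) g -> (ht g <= ht f)%O.
  move=> fg; apply: (ht_least g).2; rewrite /inC /= -(eq_cylinder_initial fg).
  exact: (ht_least f).1.
have block_eq f g : cylinder (initial f (ht f)) g ->
    cylinder (initial f (ht f)) = cylinder (initial g (ht g)).
  move=> fg; suff ht_eq : ht f = ht g.
    by rewrite -ht_eq; exact: eq_cylinder_initial.
  apply: le_anti; rewrite (ht_le _ _ fg) andbT; apply: (ht_le).
  (* It remains to see that [f] lies in the block of [g]. As [ht g <= ht f], that block contains the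
     cylinder of [g] at level [ht f], which is the block of [f]. *)
  apply: (cylinder_initial_mono (ht_le _ _ fg)).
  by rewrite -(eq_cylinder_initial fg); exact: cylinder_initial_self.
exists [set box_base (initial f (ht f)) | f in [set: box_space hK]]; split.
- split=> [|_ [f _ <-]]; last exact: (ht_least f).1.
  apply/seteqP; split=> // f _; exists (box_base (initial f (ht f))).
    by exists f.
  exact: cylinder_initial_self.
- by move=> _ [f _ <-]; exists (initial f (ht f)) => //; exact: small_initial.
(* Two blocks with a common point [h] both equal the block of [h]. *)
move=> _ _ [f _ <-] [g _ <-] [h [fh gh]].
by rewrite /box_base (block_eq _ _ fh) (block_eq _ _ gh).
Qed.

End InitialCylinders.

Theorem theorem7p5 (d : Order.disp_t) (K : orderType d)
    (hK : infinite_regular_cardinal K) :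
  b_ultraparacompact (canonical_base hK) /\ paracompact (box_space hK).
Proof.
have bup := @box_space_b_ultraparacompact d K hK; split=> //.
apply: b_ultraparacompact_paracompact bup; last exact: open_canonical_base.
exact: box_space_hausdorff.
Qed.
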